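(* Let $\mathcal{G}$ be an ultragraph, $R$ a unital commutative ring, $\mathcal{A}$ a ring, and $\Phi:L_R(\mathcal{G})\to\mathcal{A}$ a ring homomorphism. Then $\Phi$ is injective if and only if the restriction of $\Phi$ to the abelian core $M(L_R(\mathcal{G}))$ is injective.
   Context: An ultragraph is a quadruple $\mathcal{G}=(G^0,\mathcal{G}^1,r,s)$ with $G^0,\mathcal{G}^1$ countable sets, $s:\mathcal{G}^1\to G^0$, $r:\mathcal{G}^1\to P(G^0)\setminus\{\emptyset\}$ ($P$ = power set). $\mathcal{G}^0\subseteq P(G^0)$ is the smallest family containing $\emptyset$, all $\{v\}$, all $r(e)$, and closed under finite unions and finite intersections. A sink is a vertex $v$ with $s^{-1}(v)=\emptyset$. $L_R(\mathcal{G})$ is the universal (not necessarily unital) $R$-algebra with generators $\{s_e,s_e^*:e\in\mathcal{G}^1\}\cup\{p_A:A\in\mathcal{G}^0\}$ and relations: (1) $p_\emptyset=0$, $p_Ap_B=p_{A\cap B}$, $p_{A\cup B}=p_A+p_B-p_{A\cap B}$ for $A,B\in\mathcal{G}^0$; (2) $p_{s(e)}s_e=s_ep_{r(e)}=s_e$, $p_{r(e)}s_e^*=s_e^*p_{s(e)}=s_e^*$; (3) $s_e^*s_f=\delta_{e,f}p_{r(e)}$ for $e,f\in\mathcal{G}^1$; (4) $p_v=\sum_{s(e)=v}s_es_e^*$ whenever $0<|s^{-1}(v)|<\infty$ ($p_v=p_{\{v\}}$). Paths. $\mathcal{L}^*$ consists of the empty word $\omega$ and all words $e_1\cdots e_n$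 ($n\ge1$) of edges with $s(e_{i+1})\in r(e_i)$. For $\alpha=e_1\cdots e_n$, $s(\alpha)=s(e_1)$, $r(\alpha)=r(e_n)$; $r(\omega)=G^0$. A loop is a path $\alpha$ with $|\alpha|\ge1$ and $s(\alpha)\in r(\alpha)$. An exit for a loop $\alpha=\alpha_1\cdots\alpha_n$ is either an edge $e$ such that for some $i$, $s(e)\in r(\alpha_i)$ but $e\ne\alpha_{i+1}$ (with $\alpha_{n+1}=\alpha_1$), or a sink $w$ with $w\in r(\alpha_i)$ for some $i$. Abelian core. For $\alpha=\alpha_1\cdots\alpha_n$ put $s_\alpha=s_{\alpha_1}\cdots s_{\alpha_n}$, $s_{\alpha^*}=s_{\alpha_n}^*\cdots s_{\alpha_1}^*$; factors indexed by $\omega$ are omitted. $M(L_R(\mathcal{G}))$ is the $R$-subalgebra of $L_R(\mathcal{G})$ generated by the elements $s_\alpha p_As_{\beta^*}$ with $\alpha,\beta\in\mathcal{L}^*$, $A\in\mathcal{G}^0$, $r(\alpha)\cap A\cap r(\beta)\neq\emptyset$, such that: $\alpha=\beta$; or $\alpha=\beta\lambda$ with $\lambda$ a loop without exits; or $\beta=\alpha\lambda$ with $\lambda$ a loop without exits. *)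

(* Defs.v *)
From HB Require Import structures.
From mathcomp Require Import all_boot all_algebra.
From mathcomp Require Import boolp classical_sets.

Set Implicit Arguments.
Unset Strict Implicit.
Unset Printing Implicit Defensive.

Import GRing.Theory.
Local Open Scope classical_set_scope.
Local Open Scope ring_scope.
Local Open Scope quotient_scope.

(* Rings and algebras without unit: MathComp's rings all carry a 1, whereas
   L_R(G) is unital only when the whole vertex set belongs to G^0. *)
HB.mixin Record Zmodule_isNuRing V of GRing.Zmodule V := {
  numul : V -> V -> V;
  numulA : associative numul;
  numulDl : left_distributive numul +%R;
  numulDr : right_distributive numul +%R
}.

#[short(type="nuRingType")]
HB.structure Definition NuRing := {V of GRing.Zmodule V & Zmodule_isNuRing V}.

Notation "x ** y" := (numul x y) (at level 40, left associativity) : ring_scope.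

HB.mixin Record NuRing_isNuAlgebra (R : pzRingType) V
    of NuRing V & GRing.Lmodule R V := {
  nuscaleAl : forall (a : R) (x y : V), a *: (x ** y) = (a *: x) ** y;
  nuscaleAr : forall (a : R) (x y : V), a *: (x ** y) = x ** (a *: y)
}.

#[short(type="nuAlgType")]
HB.structure Definition NuAlgebra (R : pzRingType) :=
  {V of NuRing V & GRing.Lmodule R V & NuRing_isNuAlgebra R V}.

Definition nu_subalgebra (R : pzRingType) (L : nuAlgType R) (B : set L) : Prop :=
  [/\ B 0,
      forall x y, B x -> B y -> B (x + y),
      forall (a : R) x, B x -> B (a *: x)
    & forall x y, B x -> B y -> B (x ** y)].

Definition nu_generated (R : pzRingType) (L : nuAlgType R) (S : set L) : set L :=
  smallest (@nu_subalgebra R L) S.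

Record ultragraph := Ultragraph {
  vertex : countType;
  edge : countType;
  src : edge -> vertex;
  rng : edge -> set vertex;
  rng_neq0 : forall e, rng e !=set0
}.

Section Ultragraph.
Variable G : ultragraph.
Implicit Types (e : edge G) (v : vertex G) (A B : set (vertex G)).

(* The family G^0 of generalized vertices.  The intersections are nonempty
   ones: the set of all vertices need not belong to G^0. *)
Inductive gvertex : set (vertex G) -> Prop :=
| gvertex0 : gvertex set0
| gvertex1 v : gvertex [set v]
| gvertexr e : gvertex (rng e)
| gvertexU A B : gvertex A -> gvertex B -> gvertex (A `|` B)
| gvertexI A B : gvertex A -> gvertex B -> gvertex (A `&` B).

Record gvset := GVSet { gvset_set :> set (vertex G); gvsetP : gvertex gvset_set }.

Definition gv0 : gvset := GVSet gvertex0.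
Definition gv1 v : gvset := GVSet (gvertex1 v).
Definition gvr e : gvset := GVSet (gvertexr e).
Definition gvU (A B : gvset) : gvset := GVSet (gvertexU (gvsetP A) (gvsetP B)).
Definition gvI (A B : gvset) : gvset := GVSet (gvertexI (gvsetP A) (gvsetP B)).

Definition is_sink v : Prop := forall e, src e <> v.

(* es lists without repetition the edges with source v, and there is at least
   one: such a list exists if and only if 0 < |s^-1(v)| < oo. *)
Definition emits v (es : seq (edge G)) : Prop :=
  [/\ uniq es, es <> [::] & forall e, (e \in es) = (src e == v)].

(* A path is a word of edges, the empty word omega being [::]. *)
Definition is_path (w : seq (edge G)) : bool :=
  sorted (fun e f => src f \in rng e) w.

Definition path_rng (w : seq (edge G)) : set (vertex G) :=
  if w is e :: w' then rng (last e w') else setT.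

Definition is_loop (w : seq (edge G)) : Prop :=
  if w is e :: _ then is_path w /\ path_rng w (src e) else False.

(* Indices start from 0 and are read cyclically; both are within bounds, so
   that the default value of nth is immaterial. *)
Definition edge_exit (w : seq (edge G)) e : Prop :=
  exists i, [/\ (i < size w)%N, rng (nth e w i) (src e)
              & e <> nth e w (i.+1 %% size w)%N].

Definition sink_exit (w : seq (edge G)) v : Prop :=
  is_sink v /\ exists2 e, e \in w & rng e v.

Definition loop_without_exits (w : seq (edge G)) : Prop :=
  [/\ is_loop w, forall e, ~ edge_exit w e & forall v, ~ sink_exit w v].

End Ultragraph.

Arguments gv0 {G}.

Section LeavittAlgebra.
Variables (R : comPzRingType) (G : ultragraph).

Inductive lterm :=
| LS of edge G
| LSstar of edge G
| LP of gvset G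
| LZero
| LAdd of lterm & lterm
| LOpp of lterm
| LScale of R & lterm
| LMul of lterm & lterm.

(* The defining relations of L_R(G).  Relation lv_gv identifies the generators
   attached to one and the same set, whatever the proof that it lies in G^0. *)
Inductive leavitt_rel : lterm -> lterm -> Prop :=
| lv_gv (A B : gvset G) : A = B :> set (vertex G) -> leavitt_rel (LP A) (LP B)
| lv_p0 : leavitt_rel (LP gv0) LZero
| lv_pI (A B : gvset G) :
    leavitt_rel (LMul (LP A) (LP B)) (LP (gvI A B))
| lv_pU (A B : gvset G) :
    leavitt_rel (LP (gvU A B))
                (LAdd (LAdd (LP A) (LP B)) (LOpp (LP (gvI A B))))
| lv_ps e : leavitt_rel (LMul (LP (gv1 (src e))) (LS e)) (LS e)
| lv_sp e : leavitt_rel (LMul (LS e) (LP (gvr e))) (LS e)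
| lv_ps' e : leavitt_rel (LMul (LP (gvr e)) (LSstar e)) (LSstar e)
| lv_s'p e : leavitt_rel (LMul (LSstar e) (LP (gv1 (src e)))) (LSstar e)
| lv_s's e f :
    leavitt_rel (LMul (LSstar e) (LS f)) (if e == f then LP (gvr e) else LZero)
| lv_sum v es : emits v es ->
    leavitt_rel (LP (gv1 v)) (\big[LAdd/LZero]_(e <- es) LMul (LS e) (LSstar e)).

(* The congruence they generate together with the axioms of R-algebras. *)
Inductive leavitt_eq : lterm -> lterm -> Prop :=
| lv_rel t u : leavitt_rel t u -> leavitt_eq t u
| lv_refl t : leavitt_eq t t
| lv_sym t u : leavitt_eq t u -> leavitt_eq u t
| lv_trans t u v : leavitt_eq t u -> leavitt_eq u v -> leavitt_eq t v
| lv_add t t' u u' :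
    leavitt_eq t t' -> leavitt_eq u u' -> leavitt_eq (LAdd t u) (LAdd t' u')
| lv_opp t t' : leavitt_eq t t' -> leavitt_eq (LOpp t) (LOpp t')
| lv_scale a t t' : leavitt_eq t t' -> leavitt_eq (LScale a t) (LScale a t')
| lv_mul t t' u u' :
    leavitt_eq t t' -> leavitt_eq u u' -> leavitt_eq (LMul t u) (LMul t' u')
| lv_addA t u v : leavitt_eq (LAdd t (LAdd u v)) (LAdd (LAdd t u) v)
| lv_addC t u : leavitt_eq (LAdd t u) (LAdd u t)
| lv_add0 t : leavitt_eq (LAdd LZero t) t
| lv_addN t : leavitt_eq (LAdd (LOpp t) t) LZero
| lv_scaleA a b t : leavitt_eq (LScale a (LScale b t)) (LScale (a * b) t)
| lv_scale1 t : leavitt_eq (LScale 1 t) t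
| lv_scaleDr a t u :
    leavitt_eq (LScale a (LAdd t u)) (LAdd (LScale a t) (LScale a u))
| lv_scaleDl a b t :
    leavitt_eq (LScale (a + b) t) (LAdd (LScale a t) (LScale b t))
| lv_mulA t u v : leavitt_eq (LMul t (LMul u v)) (LMul (LMul t u) v)
| lv_mulDl t u v :
    leavitt_eq (LMul (LAdd t u) v) (LAdd (LMul t v) (LMul u v))
| lv_mulDr t u v :
    leavitt_eq (LMul t (LAdd u v)) (LAdd (LMul t u) (LMul t v))
| lv_scaleAl a t u :
    leavitt_eq (LScale a (LMul t u)) (LMul (LScale a t) u)
| lv_scaleAr a t u :
    leavitt_eq (LScale a (LMul t u)) (LMul t (LScale a u)).

HB.instance Definition _ := gen_eqMixin lterm.
HB.instance Definition _ := gen_choiceMixin lterm.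

Definition leavitt_eqb : rel lterm := fun t u => `[< leavitt_eq t u >].

Lemma leavitt_eqb_refl : reflexive leavitt_eqb.
Proof. by move=> t; apply/asboolP; exact: lv_refl. Qed.

Lemma leavitt_eqb_sym : symmetric leavitt_eqb.
Proof. by move=> t u; apply: asbool_equiv_eq; split; exact: lv_sym. Qed.

Lemma leavitt_eqb_trans : transitive leavitt_eqb.
Proof.
by move=> u t v /asboolP tu /asboolP uv; apply/asboolP; exact: lv_trans tu uv.
Qed.

Canonical leavitt_equiv :=
  EquivRel leavitt_eqb leavitt_eqb_refl leavitt_eqb_sym leavitt_eqb_trans.

Definition leavitt : Type := {eq_quot leavitt_equiv}.

HB.instance Definition _ := Choice.on leavitt.
HB.instance Definition _ := EqQuotient.on leavitt.

Lemma leavitt_piE (t u : lterm) :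
  (\pi_leavitt t = \pi_leavitt u) <-> leavitt_eq t u.
Proof.
split=> [|tu]; last by apply/eqmodP/asboolP.
by move/eqmodP/asboolP.
Qed.

Lemma leavitt_reprP (t : lterm) : leavitt_eq (repr (\pi_leavitt t)) t.
Proof. by apply/leavitt_piE; rewrite reprK. Qed.

Definition leavitt_add (x y : leavitt) : leavitt := \pi_leavitt (LAdd (repr x) (repr y)).
Definition leavitt_opp (x : leavitt) : leavitt := \pi_leavitt (LOpp (repr x)).
Definition leavitt_scale (a : R) (x : leavitt) : leavitt :=
  \pi_leavitt (LScale a (repr x)).
Definition leavitt_mul (x y : leavitt) : leavitt := \pi_leavitt (LMul (repr x) (repr y)).

Lemma pi_add t u : leavitt_add (\pi_leavitt t) (\pi_leavitt u) = \pi_leavitt (LAdd t u).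
Proof. by apply/leavitt_piE; apply: lv_add; apply: leavitt_reprP. Qed.

Lemma pi_opp t : leavitt_opp (\pi_leavitt t) = \pi_leavitt (LOpp t).
Proof. by apply/leavitt_piE; apply: lv_opp; apply: leavitt_reprP. Qed.

Lemma pi_scale a t : leavitt_scale a (\pi_leavitt t) = \pi_leavitt (LScale a t).
Proof. by apply/leavitt_piE; apply: lv_scale; apply: leavitt_reprP. Qed.

Lemma pi_mul t u : leavitt_mul (\pi_leavitt t) (\pi_leavitt u) = \pi_leavitt (LMul t u).
Proof. by apply/leavitt_piE; apply: lv_mul; apply: leavitt_reprP. Qed.

Lemma leavitt_addA : associative leavitt_add.
Proof.
elim/quotW=> t; elim/quotW=> u; elim/quotW=> v.
rewrite (pi_add u v) (pi_add t u) (pi_add t) (pi_add _ v).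
by apply/leavitt_piE; apply: lv_addA.
Qed.

Lemma leavitt_addC : commutative leavitt_add.
Proof.
elim/quotW=> t; elim/quotW=> u; rewrite (pi_add t u) (pi_add u t).
by apply/leavitt_piE; apply: lv_addC.
Qed.

Lemma leavitt_add0 : left_id (\pi_leavitt LZero) leavitt_add.
Proof.
by elim/quotW=> t; rewrite (pi_add _ t); apply/leavitt_piE; apply: lv_add0.
Qed.

Lemma leavitt_addN : left_inverse (\pi_leavitt LZero) leavitt_opp leavitt_add.
Proof.
elim/quotW=> t; rewrite (pi_opp t) (pi_add _ t).
by apply/leavitt_piE; apply: lv_addN.
Qed.

HB.instance Definition _ :=
  GRing.isZmodule.Build leavitt leavitt_addA leavitt_addC leavitt_add0
    leavitt_addN.

Lemma leavitt_addE t u : \pi_leavitt t + \pi_leavitt u = \pi_leavitt (LAdd t u).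
Proof. exact: pi_add. Qed.

Lemma leavitt_oppE t : - \pi_leavitt t = \pi_leavitt (LOpp t).
Proof. exact: pi_opp. Qed.

Lemma leavitt_scaleA a b (x : leavitt) :
  leavitt_scale a (leavitt_scale b x) = leavitt_scale (a * b) x.
Proof.
elim/quotW: x => t; rewrite (pi_scale b t) (pi_scale _ t) (pi_scale a).
by apply/leavitt_piE; apply: lv_scaleA.
Qed.

Lemma leavitt_scale1 : left_id 1 leavitt_scale.
Proof.
by elim/quotW=> t; rewrite (pi_scale _ t); apply/leavitt_piE; apply: lv_scale1.
Qed.

Lemma leavitt_scaleDr : right_distributive leavitt_scale +%R.
Proof.
move=> a; elim/quotW=> t; elim/quotW=> u.
rewrite leavitt_addE (pi_scale a t) (pi_scale a u) (pi_scale a (LAdd t u)).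
by rewrite leavitt_addE; apply/leavitt_piE; apply: lv_scaleDr.
Qed.

Lemma leavitt_scaleDl (x : leavitt) :
  {morph leavitt_scale^~ x : a b / a + b}.
Proof.
move=> a b; elim/quotW: x => t.
rewrite (pi_scale a t) (pi_scale b t) (pi_scale (a + b) t) leavitt_addE.
by apply/leavitt_piE; apply: lv_scaleDl.
Qed.

HB.instance Definition _ :=
  GRing.Zmodule_isLmodule.Build R leavitt leavitt_scaleA leavitt_scale1
    leavitt_scaleDr leavitt_scaleDl.

Lemma leavitt_scaleE a t : a *: \pi_leavitt t = \pi_leavitt (LScale a t).
Proof. exact: pi_scale. Qed.

Lemma leavitt_mulA : associative leavitt_mul.
Proof.
elim/quotW=> t; elim/quotW=> u; elim/quotW=> v.
rewrite (pi_mul u v) (pi_mul t u) (pi_mul t) (pi_mul _ v).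
by apply/leavitt_piE; apply: lv_mulA.
Qed.

Lemma leavitt_mulDl : left_distributive leavitt_mul +%R.
Proof.
elim/quotW=> t; elim/quotW=> u; elim/quotW=> v.
rewrite leavitt_addE (pi_mul t v) (pi_mul u v) (pi_mul (LAdd t u) v).
by rewrite leavitt_addE; apply/leavitt_piE; apply: lv_mulDl.
Qed.

Lemma leavitt_mulDr : right_distributive leavitt_mul +%R.
Proof.
elim/quotW=> t; elim/quotW=> u; elim/quotW=> v.
rewrite leavitt_addE (pi_mul t u) (pi_mul t v) (pi_mul t (LAdd u v)).
by rewrite leavitt_addE; apply/leavitt_piE; apply: lv_mulDr.
Qed.

HB.instance Definition _ :=
  Zmodule_isNuRing.Build leavitt leavitt_mulA leavitt_mulDl leavitt_mulDr.

Lemma leavitt_mulE t u :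
  \pi_leavitt t ** \pi_leavitt u = \pi_leavitt (LMul t u).
Proof. exact: pi_mul. Qed.

Lemma leavitt_scaleAl (a : R) (x y : leavitt) : a *: (x ** y) = (a *: x) ** y.
Proof.
elim/quotW: x => t; elim/quotW: y => u.
rewrite leavitt_mulE !leavitt_scaleE leavitt_mulE.
by apply/leavitt_piE; apply: lv_scaleAl.
Qed.

Lemma leavitt_scaleAr (a : R) (x y : leavitt) : a *: (x ** y) = x ** (a *: y).
Proof.
elim/quotW: x => t; elim/quotW: y => u.
rewrite leavitt_mulE !leavitt_scaleE leavitt_mulE.
by apply/leavitt_piE; apply: lv_scaleAr.
Qed.

HB.instance Definition _ :=
  NuRing_isNuAlgebra.Build R leavitt leavitt_scaleAl leavitt_scaleAr.

Definition gs (e : edge G) : leavitt := \pi_leavitt (LS e).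
Definition gs' (e : edge G) : leavitt := \pi_leavitt (LSstar e).
Definition gp (A : gvset G) : leavitt := \pi_leavitt (LP A).

Record leavitt_family (B : nuAlgType R) (s s' : edge G -> B) (p : gvset G -> B)
    : Prop := LeavittFamily {
  lf_gv : forall A A' : gvset G, A = A' :> set (vertex G) -> p A = p A';
  lf_p0 : p gv0 = 0;
  lf_pI : forall A A', p A ** p A' = p (gvI A A');
  lf_pU : forall A A', p (gvU A A') = p A + p A' - p (gvI A A');
  lf_ps : forall e, p (gv1 (src e)) ** s e = s e;
  lf_sp : forall e, s e ** p (gvr e) = s e;
  lf_ps' : forall e, p (gvr e) ** s' e = s' e;
  lf_s'p : forall e, s' e ** p (gv1 (src e)) = s' e;
  lf_s's : forall e f, s' e ** s f = if e == f then p (gvr e) else 0;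
  lf_sum : forall v es, emits v es -> p (gv1 v) = \sum_(e <- es) s e ** s' e
}.

Lemma leavitt_generators : leavitt_family gs gs' gp.
Proof.
split; rewrite /gs /gs' /gp.
- by move=> A A' AA'; apply/leavitt_piE/lv_rel/lv_gv.
- by apply/leavitt_piE/lv_rel/lv_p0.
- by move=> A A'; rewrite leavitt_mulE; apply/leavitt_piE/lv_rel/lv_pI.
- move=> A A'; rewrite (leavitt_addE (LP A) (LP A')).
  rewrite (leavitt_oppE (LP (gvI A A'))) (leavitt_addE (LAdd _ _) (LOpp _)).
  by apply/leavitt_piE/lv_rel/lv_pU.
- by move=> e; rewrite leavitt_mulE; apply/leavitt_piE/lv_rel/lv_ps.
- by move=> e; rewrite leavitt_mulE; apply/leavitt_piE/lv_rel/lv_sp.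
- by move=> e; rewrite leavitt_mulE; apply/leavitt_piE/lv_rel/lv_ps'.
- by move=> e; rewrite leavitt_mulE; apply/leavitt_piE/lv_rel/lv_s'p.
- move=> e f; rewrite leavitt_mulE -[0]/(\pi_leavitt LZero).
  rewrite -(fun_if (fun t => \pi_leavitt t)).
  by apply/leavitt_piE/lv_rel/lv_s's.
- move=> v es vs; transitivity
      (\pi_leavitt (\big[LAdd/LZero]_(e <- es) LMul (LS e) (LSstar e))).
    by apply/leavitt_piE/lv_rel/lv_sum.
  elim: es {vs} => [|e es IH]; first by rewrite !big_nil.
  by rewrite !big_cons -IH leavitt_mulE leavitt_addE.
Qed.

Fixpoint lterm_eval (B : nuAlgType R) (s s' : edge G -> B) (p : gvset G -> B)
    (t : lterm) : B :=
  match t with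
  | LS e => s e
  | LSstar e => s' e
  | LP A => p A
  | LZero => 0
  | LAdd t u => lterm_eval s s' p t + lterm_eval s s' p u
  | LOpp t => - lterm_eval s s' p t
  | LScale a t => a *: lterm_eval s s' p t
  | LMul t u => lterm_eval s s' p t ** lterm_eval s s' p u
  end.

Lemma lterm_eval_eq (B : nuAlgType R) (s s' : edge G -> B) (p : gvset G -> B) :
  leavitt_family s s' p ->
  forall t u, leavitt_eq t u -> lterm_eval s s' p t = lterm_eval s s' p u.
Proof.
move=> F t u; elim=> {t u} //=.
- move=> t u; case=> [A A' AA'||A A'|A A'|e|e|e|e|e f|v es vs] /=.
  + exact: lf_gv F _ _ AA'.
  + exact: lf_p0 F.
  + exact: lf_pI F _ _.
  + exact: lf_pU F _ _.
  + exact: lf_ps F _.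
  + exact: lf_sp F _.
  + exact: lf_ps' F _.
  + exact: lf_s'p F _.
  + by rewrite (lf_s's F); case: ifP.
  + rewrite (lf_sum F vs); elim: es {vs} => [|e es IH]; first by rewrite !big_nil.
    by rewrite !big_cons /= IH.
- by move=> t u v _ -> _ ->.
- by move=> t t' u u' _ -> _ ->.
- by move=> t t' _ ->.
- by move=> a t t' _ ->.
- by move=> t t' u u' _ -> _ ->.
- by move=> *; rewrite addrA.
- by move=> *; rewrite addrC.
- by move=> *; rewrite add0r.
- by move=> *; rewrite addNr.
- by move=> *; rewrite scalerA.
- by move=> *; rewrite scale1r.
- by move=> *; rewrite scalerDr.
- by move=> *; rewrite scalerDl.
- by move=> *; rewrite numulA.
- by move=> *; rewrite numulDl.
- by move=> *; rewrite numulDr.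
- by move=> *; rewrite nuscaleAl.
- by move=> *; rewrite nuscaleAr.
Qed.

Definition extends_family (B : nuAlgType R) (s s' : edge G -> B)
    (p : gvset G -> B) (f : leavitt -> B) : Prop :=
  [/\ {morph f : x y / x ** y}, forall e, f (gs e) = s e,
      forall e, f (gs' e) = s' e & forall A, f (gp A) = p A].

Theorem leavitt_universal (B : nuAlgType R) (s s' : edge G -> B)
    (p : gvset G -> B) :
  leavitt_family s s' p ->
  exists2 f : {linear leavitt -> B}, extends_family s s' p f
    & forall g : {linear leavitt -> B}, extends_family s s' p g -> f =1 g.
Proof.
move=> F; pose h (x : leavitt) := lterm_eval s s' p (repr x).
have hE t : h (\pi_leavitt t) = lterm_eval s s' p t.
  by apply: lterm_eval_eq F _ _ _; exact: leavitt_reprP.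
have h_lin : linear h.
  move=> a; elim/quotW=> t; elim/quotW=> u.
  by rewrite leavitt_scaleE leavitt_addE !hE.
pose hL := GRing.isLinear.Build R leavitt B *:%R h h_lin.
pose f : {linear leavitt -> B} := HB.pack h hL.
have fE : f =1 h by [].
exists f.
  split=> [|e|e|A]; rewrite ?fE ?hE //.
  by elim/quotW=> t; elim/quotW=> u; rewrite leavitt_mulE !fE !hE.
move=> g [gM gS gS' gP].
elim/quotW=> t; rewrite fE hE.
elim: t => [e|e|A||t IHt u IHu|t IHt|a t IHt|t IHt u IHu] /=.
- by rewrite -gS.
- by rewrite -gS'.
- by rewrite -gP.
- by rewrite -[\pi_leavitt _]/(0 : leavitt) linear0.
- by rewrite IHt IHu -linearD leavitt_addE.
- by rewrite IHt -linearN leavitt_oppE.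
- by rewrite IHt -linearZ leavitt_scaleE.
- by rewrite IHt IHu -gM leavitt_mulE.
Qed.

(* The element s_alpha p_A s_{beta^*}; since L_R(G) has no unit, the factors
   are multiplied around p_A, and none is there for the empty word. *)
Definition spath (alpha : seq (edge G)) (A : gvset G) (beta : seq (edge G))
    : leavitt :=
  foldr (fun e x => gs e ** x) (foldr (fun e x => x ** gs' e) (gp A) beta) alpha.

Definition core_generators : set leavitt :=
  [set x | exists alpha A beta,
    [/\ x = spath alpha A beta, is_path alpha, is_path beta,
        path_rng alpha `&` A `&` path_rng beta !=set0
      & [\/ alpha = beta,
            exists2 lam, loop_without_exits lam & alpha = beta ++ lam
          | exists2 lam, loop_without_exits lam & beta = alpha ++ lam]]].

Definition abelian_core : set leavitt := nu_generated core_generators.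

End LeavittAlgebra.

Arguments abelian_core R G : clear implicits.

(* Main.v *)
From HB Require Import structures.
Require Import Defs.
From mathcomp Require Import all_boot all_algebra.
From mathcomp Require Import boolp classical_sets.

Set Implicit Arguments.
Unset Strict Implicit.
Unset Printing Implicit Defensive.

Import GRing.Theory.
Local Open Scope classical_set_scope.
Local Open Scope ring_scope.
Local Open Scope quotient_scope.

(** Phi is injective as soon as its kernel I, a two-sided ideal, vanishes; and
    I contains no nonzero element of the abelian core.  So everything reduces
    to showing that an ideal I with this property is zero, which is done by
    compressing an element of I, with products on both sides, until it lies in
    the core.

    The starting point is an element c p_v + sum_ga d_ga s_ga p_v of I in which
    the ga are closed paths at v of positive length.  If none of the ga has an
    exit, the element is in the core, hence zero.  Otherwise a path mu from v
    follows a loop ga that has an exit for long enough, leaves it there and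
    arrives at a vertex w; then p_w s_mu^* kills every s_ga s_mu p_w, and the
    element compresses to c p_w, which is in the core, hence zero
    ([exit_word]).  In both cases c = 0, because L_R(G) acts on the functions of
    a boundary path and an integer degree, where c p_v acts as 0 only if c = 0
    and the terms in s_ga act in other degrees ([vertex_coef_eq0]).

    Next, if a combination of s_al p_v over distinct paths al is in I, then all
    its coefficients vanish: multiplying by s_be^* for a shortest be with
    a nonzero coefficient gives an element of the previous kind
    ([path_coef_eq0]).

    Finally let x in I be a combination of s_al p_A s_be^*, and argue by
    induction on the largest length of the ghost parts be.  Let F be the set of
    first edges of these be.  For e in F the element x s_e has shorter ghost
    parts, so it vanishes; hence x = x (1 - sum_(e in F) s_e s_e^* ), and the
    right factor kills all terms of x but those without ghost part.  Thus
    x = y (1 - sum_(e in F) s_e s_e^* ) with y a combination of elements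
    s_al p_A.  Such a y is governed by the functions v |-> coef l al v, one for
    each path al.  At a vertex v which is not the source of an edge of F, the
    function is read off x p_v; at a vertex v which emits an edge e outside F,
    it is read off x s_e p_w for any w in r(e).  In both cases it vanishes.
    There remain the finitely many v that emit edges and only edges of F, and
    there p_v (1 - sum_(e in F) s_e s_e^* ) = 0 by the last defining relation.
    Hence x = 0 ([free_defect_eq0], [ideal_eq0]). *)

(** * Rings without unit *)

Section NuRingTheory.
Variable L : nuRingType.
Implicit Types x y z : L.

Lemma numul0r x : 0 ** x = 0.
Proof. by apply: (addrI (0 ** x)); rewrite -numulDl !addr0. Qed.

Lemma numulr0 x : x ** 0 = 0.
Proof. by apply: (addrI (x ** 0)); rewrite -numulDr !addr0. Qed.

Lemma numulrN x y : x ** (- y) = - (x ** y).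
Proof. by apply: (addrI (x ** y)); rewrite -numulDr !subrr numulr0. Qed.

Lemma numulNr x y : (- x) ** y = - (x ** y).
Proof. by apply: (addrI (x ** y)); rewrite -numulDl !subrr numul0r. Qed.

Lemma numulrB x y z : x ** (y - z) = x ** y - x ** z.
Proof. by rewrite numulDr numulrN. Qed.

Lemma numulBr x y z : (x - y) ** z = x ** z - y ** z.
Proof. by rewrite numulDl numulNr. Qed.

Lemma numul_suml I (r : seq I) (P : pred I) (F : I -> L) x :
  (\sum_(i <- r | P i) F i) ** x = \sum_(i <- r | P i) F i ** x.
Proof.
exact: (big_morph (fun y => y ** x) (fun y z => numulDl y z x) (numul0r x)).
Qed.

Lemma numul_sumr I (r : seq I) (P : pred I) (F : I -> L) x :
  x ** (\sum_(i <- r | P i) F i) = \sum_(i <- r | P i) x ** F i.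
Proof. exact: (big_morph _ (numulDr x) (numulr0 x)). Qed.

End NuRingTheory.

(** * A representation on functions of boundary paths *)

Section Representation.
Variables (R : comPzRingType) (G : ultragraph).

(** A boundary path is recorded by its successive vertices, each with the edge
    that is taken from it, or [None] once a sink is reached. *)
Definition bseq := nat -> vertex G * option (edge G).

(** The entry after a [None] need not continue it: any set of sequences will do
    that is stable under removing a first edge and adding one, and in which
    a regular vertex always comes with one of its edges. *)
Definition bvalid (x : bseq) : Prop := forall i,
  if (x i).2 is Some e then src e = (x i).1 /\ rng e (x i.+1).1
  else is_sink (x i).1.

Definition bshift (x : bseq) : bseq := fun i => x i.+1.

Definition bcons (e : edge G) (x : bseq) : bseq :=
  fun i => if i is j.+1 then x j else (src e, Some e).

Lemma bshift_valid x : bvalid x -> bvalid (bshift x).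
Proof. by move=> xV i; exact: xV i.+1. Qed.

Lemma bcons_valid e x : bvalid x -> rng e (x 0%N).1 -> bvalid (bcons e x).
Proof. by move=> xV ex [|i] //=; exact: xV i. Qed.

Lemma bcons_shift e x : bvalid x -> (x 0%N).2 = Some e -> bcons e (bshift x) = x.
Proof.
move=> xV xe; apply: funext => -[|i] //=.
by have := xV 0%N; case: (x 0%N) xe => u o /= -> [->].
Qed.

(** Keep choosing an edge and a vertex in its range until a sink is met; this is
    what makes each p_v act faithfully. *)
Lemma exists_bseq v : exists2 x, bvalid x & (x 0%N).1 = v.
Proof.
have step (u : vertex G) : exists ow : option (edge G) * vertex G,
    if ow.1 is Some e then src e = u /\ rng e ow.2 else is_sink u.
  have [us|] := pselect (is_sink u); first by exists (None, u).
  move=> /existsNP[e /contrapT eu]; have [w ew] := rng_neq0 e.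
  by exists (Some e, w).
have [f fP] := choice step.
pose u i := iter i (fun w => (f w).2) v.
exists (fun i => (u i, (f (u i)).1)) => // i /=.
exact: fP (u i).
Qed.

(** The generators act on functions of a boundary path and an integer: s_e
    deletes a first edge e, s_e^* adds it, p_A restricts.  The integer counts
    the edges removed, so that s_e and s_e^* shift it in opposite directions.  Sequences that
    are not boundary paths are sent to 0 by every generator. *)
Fixpoint rep (t : lterm R G) (phi : bseq -> int -> R) (x : bseq) (n : int) : R :=
  match t with
  | LS e =>
      if `[< bvalid x /\ (x 0%N).2 = Some e >] then phi (bshift x) (n + 1) else 0
  | LSstar e =>
      if `[< bvalid x /\ rng e (x 0%N).1 >] then phi (bcons e x) (n - 1) else 0
  | LP A => if `[< bvalid x /\ gvset_set A (x 0%N).1 >] then phi x n else 0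
  | LZero => 0
  | LAdd t u => rep t phi x n + rep u phi x n
  | LOpp t => - rep t phi x n
  | LScale a t => a * rep t phi x n
  | LMul t u => rep t (rep u phi) x n
  end.

Lemma rep_linear t a phi psi :
  rep t (fun x n => a * phi x n + psi x n) =
  (fun x n => a * rep t phi x n + rep t psi x n).
Proof.
elim: t phi psi => [e|e|A||t IHt u IHu|t IHt|b t IHt|t IHt u IHu] phi psi;
  apply: funext => x; apply: funext => n /=.
- by case: ifP; rewrite ?mulr0 ?addr0.
- by case: ifP; rewrite ?mulr0 ?addr0.
- by case: ifP; rewrite ?mulr0 ?addr0.
- by rewrite mulr0 addr0.
- by rewrite IHt IHu mulrDr addrACA.
- by rewrite IHt opprD mulrN.
- by rewrite IHt mulrDr !mulrA (mulrC b).
- by rewrite IHu IHt.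
Qed.

Lemma rep_sum (I : Type) (r : seq I) (t : I -> lterm R G) phi x n :
  rep (\big[@LAdd R G/LZero R G]_(i <- r) t i) phi x n =
  \sum_(i <- r) rep (t i) phi x n.
Proof. by elim: r => [|i r IH]; rewrite ?big_nil // !big_cons /= IH. Qed.

Lemma rep_rel t u : leavitt_rel t u -> rep t = rep u.
Proof.
move=> tu; apply: funext => phi; apply: funext => x; apply: funext => n.
case: tu => [A B AB||A B|A B|e|e|e|e|e f|v es [esU esN0 esP]] /=.
- by rewrite AB.
- by case: asboolP => // -[].
- rewrite /setI /mkset; do !case: asboolP => //=; tauto.
- rewrite /setI /setU /mkset.
  do !case: asboolP => /= ?; rewrite ?addr0 ?subr0 ?addrK ?add0r ?subrr //; tauto.
- case: asboolP => // xP; case: asboolP => // xe; case: xP.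
  case: xe => xV xe; split=> //=.
  by have := xV 0%N; rewrite xe => -[].
- case: asboolP => // -[xV xe]; case: asboolP => // xP; case: xP.
  split; first exact: bshift_valid.
  by have := xV 0%N; rewrite xe => -[].
- by do 2![case: asboolP => //=].
- case: asboolP => // -[xV xe]; case: asboolP => // xP; case: xP.
  by split => //; exact: bcons_valid.
- case: asboolP => [[xV xe]|xP]; last first.
    by case: eqP => //= _; case: asboolP.
  case: asboolP => /= [[_ [ef]]|]; last first.
    case: eqP => //= <- nP; case: nP; split=> //; exact: bcons_valid.
  by rewrite -ef eqxx /= subrK; case: asboolP => // nP; case: nP.
- rewrite rep_sum /=; case: asboolP => [[xV xv]|xP]; last first.
    rewrite big_seq big1 // => e; rewrite esP => /eqP ev.
    case: asboolP => // -[xV xe]; case: xP; split=> //=.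
    by have := xV 0%N; rewrite xe ev => -[->].
  have := xV 0%N; case xe: (x 0%N).2 => [e|]; last first.
    move=> xs; case: es esN0 esP {esU} => // f es _ /(_ f).
    by rewrite mem_head => /esym/eqP fv; case: (xs f); rewrite fv xv.
  move=> [ev e1]; rewrite (bigD1_seq e) //=; last by rewrite esP ev xv.
  rewrite asboolT // asboolT; last by split=> //; exact: bshift_valid.
  rewrite bcons_shift // addrK big1 ?addr0 // => f fe.
  by case: asboolP => // -[_] [ef]; rewrite ef eqxx in fe.
Qed.

Lemma rep_eq t u : leavitt_eq t u -> rep t = rep u.
Proof.
have ext (f g : (bseq -> int -> R) -> bseq -> int -> R) :
    (forall phi x n, f phi x n = g phi x n) -> f = g.
  by move=> fg; do 3!apply: funext => ?; exact: fg.
elim=> {t u}.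
- exact: rep_rel.
- by [].
- by move=> t u _ ->.
- by move=> t u v _ -> _ ->.
- by move=> t t' u u' _ IHt _ IHu; apply: ext => phi x n /=; rewrite IHt IHu.
- by move=> t t' _ IHt; apply: ext => phi x n /=; rewrite IHt.
- by move=> a t t' _ IHt; apply: ext => phi x n /=; rewrite IHt.
- by move=> t t' u u' _ IHt _ IHu; apply: ext => phi x n /=; rewrite IHt IHu.
- by move=> t u v; apply: ext => phi x n /=; rewrite addrA.
- by move=> t u; apply: ext => phi x n /=; rewrite addrC.
- by move=> t; apply: ext => phi x n /=; rewrite add0r.
- by move=> t; apply: ext => phi x n /=; rewrite addNr.
- by move=> a b t; apply: ext => phi x n /=; rewrite mulrA.
- by move=> t; apply: ext => phi x n /=; rewrite mul1r.
- by move=> a t u; apply: ext => phi x n /=; rewrite mulrDr.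
- by move=> a b t; apply: ext => phi x n /=; rewrite mulrDl.
- by [].
- by [].
(* Right distributivity and the next scalar law need the operators linear. *)
- move=> t u v; apply: ext => phi x n /=.
  rewrite -[X in _ = X + _]mul1r.
  rewrite -[in RHS](congr1 (fun f => f x n) (rep_linear t 1 _ _)).
  by congr rep; do 2!apply: funext => ?; rewrite mul1r.
- by [].
- move=> a t u; apply: ext => phi x n /=.
  have rep0 : rep t (fun _ _ => 0) x n = 0.
    transitivity (-1 * rep t (fun _ _ => 0) x n + rep t (fun _ _ => 0) x n).
      rewrite -(congr1 (fun f => f x n) (rep_linear t (-1) _ _)).
      by congr rep; do 2!apply: funext => ?; rewrite mulr0 addr0.
    by rewrite mulN1r addNr.
  rewrite -[LHS]addr0 -rep0 -(congr1 (fun f => f x n) (rep_linear t a _ _)).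
  by congr rep; do 2!apply: funext => ?; rewrite addr0.
Qed.

Definition lrep (x : leavitt R G) := rep (repr x).

Lemma lrep_pi t : lrep (\pi_(leavitt R G) t) = rep t.
Proof. by apply: rep_eq; exact: leavitt_reprP. Qed.

Lemma lrep0 phi x n : lrep 0 phi x n = 0.
Proof. by rewrite (lrep_pi (LZero R G)). Qed.

Lemma lrepD u w phi x n : lrep (u + w) phi x n = lrep u phi x n + lrep w phi x n.
Proof.
by elim/quotW: u => t; elim/quotW: w => t'; rewrite leavitt_addE !lrep_pi.
Qed.

Lemma lrepZ a u phi x n : lrep (a *: u) phi x n = a * lrep u phi x n.
Proof. by elim/quotW: u => t; rewrite leavitt_scaleE !lrep_pi. Qed.

Lemma lrepM u w phi : lrep (u ** w) phi = lrep u (lrep w phi).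
Proof.
by elim/quotW: u => t; elim/quotW: w => t'; rewrite leavitt_mulE !lrep_pi.
Qed.

End Representation.

(** * Paths in the Leavitt algebra *)

Lemma big_fibers (V : nmodType) (T K : eqType) (r : seq T) (h : T -> K)
    (F : T -> V) :
  \sum_(t <- r) F t = \sum_(k <- undup (map h r)) \sum_(t <- r | h t == k) F t.
Proof.
rewrite (exchange_big_dep xpredT) //=; apply: eq_big_seq => t tr.
rewrite -big_filter (eq_filter (a2 := pred1 (h t))) => [|k]; last exact: eq_sym.
by rewrite filter_pred1_uniq ?undup_uniq ?mem_undup ?map_f // big_seq1.
Qed.

HB.instance Definition _ (G : ultragraph) := gen_eqMixin (gvset G).

Section PathAlgebra.
Variables (R : comPzRingType) (G : ultragraph).
Implicit Types (e f : edge G) (u v w : vertex G) (A B : gvset G).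
Implicit Types (al be ga de mu : seq (edge G)) (x y z : leavitt R G).

Local Notation L := (leavitt R G).
Local Notation s := (gs R).
Local Notation s' := (gs' R).
Local Notation p := (@gp R G).
Local Notation FAM := (leavitt_generators R G).

Lemma gp_sub A B : gvset_set A `<=` gvset_set B -> p A ** p B = p A.
Proof.
move=> AB; rewrite (lf_pI FAM); apply: (lf_gv FAM).
by rewrite /= setIidl.
Qed.

Lemma gp_mulC A B : p A ** p B = p B ** p A.
Proof. by rewrite !(lf_pI FAM); apply: (lf_gv FAM); rewrite /= setIC. Qed.

Lemma gp_disjoint A B : gvset_set A `&` gvset_set B = set0 -> p A ** p B = 0.
Proof.
by move=> AB; rewrite (lf_pI FAM) -(lf_p0 FAM); apply: (lf_gv FAM).
Qed.

Lemma gp_vertex A v :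
  p A ** p (gv1 v) = if v \in gvset_set A then p (gv1 v) else 0.
Proof.
rewrite gp_mulC; case: ifPn => [/set_mem Av|/negP vA].
  by apply: gp_sub => _ ->.
by apply: gp_disjoint; rewrite -subset0 => _ [-> /mem_set].
Qed.

Lemma gp_s A e : p A ** s e = if src e \in gvset_set A then s e else 0.
Proof.
rewrite -(lf_ps FAM) numulA gp_vertex.
by case: ifP => _; rewrite ?numul0r // (lf_ps FAM).
Qed.

Lemma s'_gp A e : s' e ** p A = if src e \in gvset_set A then s' e else 0.
Proof.
rewrite -(lf_s'p FAM) -numulA gp_mulC gp_vertex.
by case: ifP => _; rewrite ?numulr0 // (lf_s'p FAM).
Qed.

Lemma s'_s e f : s' e ** s f = if e == f then p (gvr e) else 0.
Proof. exact: lf_s's FAM e f. Qed.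

(** s_al x; as an operator it makes sense for the empty path too, although the
    algebra has no unit to play the part of its s. *)
Definition sact al x : L := foldr (fun e z => s e ** z) x al.

Lemma sactD al x y : sact al (x + y) = sact al x + sact al y.
Proof. by elim: al => //= e al ->; rewrite numulDr. Qed.

Lemma sact0 al : sact al 0 = 0.
Proof. by elim: al => //= e al ->; rewrite numulr0. Qed.

Lemma sactZ al a x : sact al (a *: x) = a *: sact al x.
Proof. by elim: al => //= e al ->; rewrite nuscaleAr. Qed.

Lemma sactM al x y : sact al (x ** y) = sact al x ** y.
Proof. by elim: al => //= e al ->; rewrite numulA. Qed.

Lemma sact_cat al be x : sact (al ++ be) x = sact al (sact be x).
Proof. exact: foldr_cat. Qed.

Lemma sact_sum al (I : Type) (r : seq I) (P : pred I) (F : I -> L) :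
  sact al (\sum_(i <- r | P i) F i) = \sum_(i <- r | P i) sact al (F i).
Proof. exact: (big_morph _ (sactD al) (sact0 al)). Qed.

(** s_al^* x, the edges of al being cancelled from the first one on. *)
Definition sstar al x : L := foldl (fun z e => s' e ** z) x al.

Lemma sstarD al x y : sstar al (x + y) = sstar al x + sstar al y.
Proof. by elim: al x y => //= e al IH x y; rewrite numulDr IH. Qed.

Lemma sstar0 al : sstar al 0 = 0.
Proof. by elim: al => //= e al IH; rewrite numulr0. Qed.

Lemma sstarZ al a x : sstar al (a *: x) = a *: sstar al x.
Proof. by elim: al x => //= e al IH x; rewrite -nuscaleAr IH. Qed.

Lemma sstar_sum al (I : Type) (r : seq I) (P : pred I) (F : I -> L) :
  sstar al (\sum_(i <- r | P i) F i) = \sum_(i <- r | P i) sstar al (F i).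
Proof. exact: (big_morph _ (sstarD al) (sstar0 al)). Qed.

Definition starts al v : Prop := if al is e :: _ then src e = v else False.

Lemma gp_sact A al x : al <> [::] ->
  p A ** sact al x = 0 \/ p A ** sact al x = sact al x.
Proof.
by case: al => //= e al _; rewrite numulA gp_s; case: ifP; rewrite ?numul0r; auto.
Qed.

Lemma gv1_sact v al x : starts al v -> p (gv1 v) ** sact al x = sact al x.
Proof. by case: al => //= e al ev; rewrite numulA gp_s mem_set ?ev. Qed.

Lemma gv1_sact0 v al x : al <> [::] -> ~ starts al v -> p (gv1 v) ** sact al x = 0.
Proof.
case: al => //= e al _ ev; rewrite numulA gp_s memNset ?numul0r //.
Qed.

Lemma is_path_catP al be v : is_path al -> path_rng al v -> is_path be ->
  starts be v -> is_path (al ++ be).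
Proof.
rewrite /is_path; case: al => //= e al eal rv; case: be => //= f be fbe fv.
by rewrite cat_path eal /= fbe andbT; apply/mem_set; rewrite fv.
Qed.

Lemma is_path_catr al be : is_path (al ++ be) -> is_path be.
Proof.
rewrite /is_path; case: al => //= e al; rewrite cat_path => /andP[_].
by case: be => //= f be /andP[].
Qed.

Lemma path_rng_catr al e be : path_rng (al ++ e :: be) = path_rng (e :: be).
Proof. by case: al => //= f al; rewrite last_cat. Qed.

(** Cancelling al leaves a factor p_(r(al)), which the path al be absorbs; when
    be is empty it is absorbed by p_v. *)
Lemma sstar_sact al be v : is_path (al ++ be) -> path_rng (al ++ be) v ->
  sstar al (sact (al ++ be) (p (gv1 v))) = sact be (p (gv1 v)).
Proof.
elim: al => //= e al IH pab rv.
rewrite numulA s'_s eqxx.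
have pab' : is_path (al ++ be) by apply: (@is_path_catr [:: e]).
suff -> : p (gvr e) ** sact (al ++ be) (p (gv1 v)) = sact (al ++ be) (p (gv1 v)).
  apply: IH => //; move: rv; case: (al ++ be) => //= f l; exact.
move: pab rv; rewrite /is_path /=; case: (al ++ be) => [_|f l] /=.
  by move=> ev; rewrite gp_vertex mem_set.
by move=> /andP[fe _] _; rewrite numulA gp_s fe.
Qed.

(** Two paths, neither of which extends the other, differ at some edge, and
    there s_e^* s_f = 0. *)
Lemma sstar_sact0 al be x : (size al <= size be)%N -> ~~ prefix al be ->
  sstar al (sact be x) = 0.
Proof.
elim: al be => [|e al IH] [|f be] //= sab; rewrite numulA s'_s.
case: eqP => [->|]; last by rewrite numul0r sstar0.
rewrite andTb => nab; have be0 : be <> [::].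
  by move=> be0; move: sab nab; rewrite be0; case: al {IH}.
by have [->|->] := gp_sact (gvr f) x be0; rewrite ?sstar0 // IH.
Qed.

Definition deg0 : bseq G -> int -> R := fun _ n => (n == 0)%:R.

(** Each edge of al lowers by one the degree where the result can live. *)
Lemma lrep_deg0 al A t n :
  n != - (size al)%:Z -> lrep (sact al (p A)) deg0 t n = 0.
Proof.
elim: al t n => [|e al IH] t n nal.
  rewrite /= lrep_pi /= /deg0; case: ifP => // _.
  by move: nal; rewrite /= oppr0 => /negPf ->.
rewrite /= lrepM lrep_pi /=; case: ifP => // _.
apply: IH; apply: contraNneq nal => nal.
by rewrite -[n](addrK 1) nal /= -addn1 PoszD opprD.
Qed.

(** Evaluate at degree 0, on a boundary path that starts at v: the terms of
    positive length have nothing there. *)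
Lemma vertex_coef_eq0 v (c : R) (d : seq (edge G) -> R) (S : seq (seq (edge G))) :
    (forall ga, ga \in S -> ga <> [::]) ->
    c *: p (gv1 v) + \sum_(ga <- S) d ga *: sact ga (p (gv1 v)) = 0 ->
  c = 0.
Proof.
move=> S0; have [t tV tv] := exists_bseq v.
move=> /(congr1 (fun z => lrep z deg0 t 0)); rewrite lrep0 lrepD lrepZ.
rewrite (big_morph (fun z => lrep z deg0 t 0) (id1 := 0) (op1 := +%R)).
- rewrite big_seq big1 => [|ga /S0 ga0].
    by rewrite addr0 lrep_pi /= asboolT ?tv // /deg0 eqxx mulr1.
  rewrite lrepZ lrep_deg0 ?mulr0 // eq_sym oppr_eq0 eqz_nat size_eq0.
  exact/eqP.
- by move=> x y; rewrite lrepD.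
- by rewrite lrep0.
Qed.

(** Each term is a multiple of a generator of the core: the second path is
    empty, and the first is empty too or extends it by the loop ga. *)
Lemma core_sum v (c : R) (d : seq (edge G) -> R) (S : seq (seq (edge G))) :
    (forall ga, ga \in S -> loop_without_exits ga /\ path_rng ga v) ->
  abelian_core R G (c *: p (gv1 v) + \sum_(ga <- S) d ga *: sact ga (p (gv1 v))).
Proof.
move=> SP B [[B0 BD BZ BM] genB]; apply: (BD).
  apply/BZ/genB; exists [::], (gv1 v), [::]; split=> //; last exact: Or31.
  by exists v.
rewrite big_seq; elim/big_ind: _ => // ga /SP[gaP gav].
apply/BZ/genB; exists ga, (gv1 v), [::]; split=> //; last by apply: Or32; exists ga.
- by case: (gaP) => + _ _; case: (ga) => //= e l [].
- by exists v.
Qed.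

(** * Combinations without ghost part *)

(** The projections p_A obey every linear relation between the characteristic
    functions of the sets A.  The family of these sets is not closed under
    differences, so the pieces of a partition are encoded as p_B - p_(B n C);
    the induction splits such a piece along the next set of the list, inside
    which c grows by its coefficient. *)
Lemma step_sum_eq0 (c : R) (r : seq (R * gvset G)) B C :
    (forall v, gvset_set B v -> ~ gvset_set C v ->
       c + \sum_(t <- r | v \in gvset_set t.2) t.1 = 0) ->
  c *: (p B - p (gvI B C)) +
    \sum_(t <- r) t.1 *: (p t.2 ** (p B - p (gvI B C))) = 0.
Proof.
elim: r c B C => [|[a A] r IH] c B C BC0.
  rewrite big_nil addr0.
  have [BC|/existsNP[v /not_implyP[Bv Cv]]] :=
    pselect (gvset_set B `<=` gvset_set C).
    by rewrite -(lf_pI FAM) gp_sub // subrr scaler0.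
  by have := BC0 v Bv Cv; rewrite big_nil addr0 => ->; rewrite scale0r.
pose u1 := p (gvI B A) - p (gvI (gvI B A) C).
pose u2 := p B - p (gvI B (gvU C A)).
have u12 : p B - p (gvI B C) = u1 + u2.
  have -> : u2 = p B - p (gvU (gvI B C) (gvI B A)).
    by congr (_ - _); apply: (lf_gv FAM); rewrite /= setIUr.
  rewrite (lf_pU FAM) /u1.
  have -> : p (gvI (gvI B C) (gvI B A)) = p (gvI (gvI B A) C).
    by apply: (lf_gv FAM); rewrite /= setIACA setIid setIA setIAC.
  rewrite [RHS]addrC -[p (gvI B C) + _ - _]addrA opprD.
  by rewrite [p B + (- _ + _)]addrA subrK.
have Au : p A ** (p B - p (gvI B C)) = u1.
  rewrite numulrB !(lf_pI FAM); congr (_ - _); apply: (lf_gv FAM) => /=.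
    exact: setIC.
  by rewrite setIA [X in X `&` _]setIC.
rewrite big_cons /= Au u12.
under eq_bigr do rewrite numulDr scalerDr.
rewrite big_split /= scalerDr [a *: u1 + _]addrA addrACA.
rewrite [c *: u1 + _]addrA -scalerDl.
rewrite IH => [|v [Bv Av] Cv]; last first.
  by have := BC0 v Bv Cv; rewrite big_cons /= mem_set // addrA.
rewrite IH ?addr0 // => v Bv /not_orP[Cv Av].
by have := BC0 v Bv Cv; rewrite big_cons /= memNset.
Qed.

(** The triple (c, al, A) stands for c s_al p_A. *)
Definition fmonom := (R * seq (edge G) * gvset G)%type.
Implicit Types (t : fmonom) (l : seq fmonom).

Definition free_sum l : L := \sum_(t <- l) t.1.1 *: sact t.1.2 (p t.2).

(** s_al p_A does not see the vertices of A outside r(al); excluding them makes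
    [coef] below vanish wherever s_al p_v does. *)
Definition admissible l : Prop := forall t, t \in l ->
  is_path t.1.2 /\ gvset_set t.2 `<=` path_rng t.1.2.

Definition coef l al v : R :=
  \sum_(t <- l | (v \in gvset_set t.2) && (t.1.2 == al)) t.1.1.

(** The hypothesis holds on B outside C, and p_B - p_(B n C) restricts to this
    region; there the terms of each path al cancel among themselves. *)
Lemma free_sum_eq0 l B C :
    (forall v, gvset_set B v -> ~ gvset_set C v -> forall al, coef l al v = 0) ->
  free_sum l ** (p B - p (gvI B C)) = 0.
Proof.
move=> l0; rewrite /free_sum numul_suml (big_fibers _ (fun t => t.1.2)).
rewrite big1 // => al _.
rewrite (eq_bigr (fun t => sact al (t.1.1 *: (p t.2 ** (p B - p (gvI B C)))))).
  rewrite -sact_sum.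
  have := @step_sum_eq0 0 [seq (t.1.1, t.2) | t <- l & t.1.2 == al] B C.
  rewrite scale0r add0r big_map big_filter => ->; first exact: sact0.
  move=> v Bv Cv; rewrite add0r big_map big_filter_cond -[RHS](l0 v Bv Cv al).
  by apply: eq_bigl => t; rewrite andbC.
by move=> t /eqP <-; rewrite sactZ sactM nuscaleAl.
Qed.

(** x (1 - sum_(e in F) s_e s_e^* ), written without the missing unit: what
    remains of x once the edges of F are split off on the right. *)
Definition defect (F : seq (edge G)) x : L := x - \sum_(e <- F) x ** s e ** s' e.

Lemma defectD F x y : defect F (x + y) = defect F x + defect F y.
Proof.
rewrite /defect (eq_bigr (fun e => x ** s e ** s' e + y ** s e ** s' e)).
  by rewrite big_split opprD addrACA.
by move=> e _; rewrite !numulDl.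
Qed.

Lemma defectM F x y : defect F (x ** y) = x ** defect F y.
Proof.
rewrite /defect numulrB numul_sumr; congr (_ - _).
by apply: eq_bigr => e _; rewrite !numulA.
Qed.

Lemma defect0 F : defect F 0 = 0.
Proof. by rewrite -{1}(numulr0 0) defectM numul0r. Qed.

Lemma defectN F x : defect F (- x) = - defect F x.
Proof. by apply: (addrI (defect F x)); rewrite -defectD !subrr defect0. Qed.

(** The edges of F with source v are then all the edges that v emits, and the
    last defining relation applies. *)
Lemma defect_vertex F v : uniq F -> (exists2 e, e \in F & src e = v) ->
  (forall e, src e = v -> e \in F) -> defect F (p (gv1 v)) = 0.
Proof.
move=> Fu [e0 e0F e0v] vF; rewrite /defect.
rewrite (eq_bigr (fun e => if src e == v then s e ** s' e else 0)); last first.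
  move=> e _; rewrite gp_s; case: eqP => ev; first by rewrite mem_set.
  by rewrite memNset ?numul0r.
rewrite -big_mkcond -big_filter.
rewrite (lf_sum FAM (es := [seq e <- F | src e == v])) ?subrr //.
split; first exact: filter_uniq.
  move=> E; have := mem_filter (fun e => src e == v) e0 F.
  by rewrite E e0v eqxx e0F.
by move=> e; rewrite mem_filter; case: eqP => //= /vF.
Qed.

Definition gvseq (T : seq (vertex G)) : gvset G :=
  foldr (fun v => gvU (gv1 v)) gv0 T.

Lemma gvseqE T v : gvset_set (gvseq T) v <-> v \in T.
Proof.
elim: T => //= u T IH; rewrite inE; split=> [[->|/IH ->]|/orP[/eqP ->|/IH]].
- by rewrite eqxx.
- by rewrite orbT.
- by left.
- by right.
Qed.

Lemma defect_gvseq F T : (forall v, v \in T -> defect F (p (gv1 v)) = 0) ->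
  defect F (p (gvseq T)) = 0.
Proof.
elim: T => [|v T IH] T0 /=; first by rewrite (lf_p0 FAM) defect0.
have {}IH : defect F (p (gvseq T)) = 0.
  by apply: IH => u uT; apply: T0; rewrite inE uT orbT.
rewrite (lf_pU FAM) -(lf_pI FAM) !defectD defectN defectM IH numulr0 addr0 subr0.
by apply: T0; rewrite mem_head.
Qed.

(** * Ghost length *)

(** The span of the s_al p_A s_be^* with be of length at most n. *)
Inductive ghost_span : nat -> L -> Prop :=
| ghost_free n l : admissible l -> ghost_span n (free_sum l)
| ghost_add n x y : ghost_span n x -> ghost_span n y -> ghost_span n (x + y)
| ghost_star n x e : ghost_span n x -> ghost_span n.+1 (x ** s' e).

Lemma free_sum_cat l1 l2 : free_sum (l1 ++ l2) = free_sum l1 + free_sum l2.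
Proof. exact: big_cat. Qed.

Lemma ghost_span_le m n x : (m <= n)%N -> ghost_span m x -> ghost_span n x.
Proof.
move=> + xm; elim: xm n => {m x} [m l lP|m x y _ IHx _ IHy|m x e _ IHx] n mn.
- exact: ghost_free.
- by apply: ghost_add; [exact: IHx|exact: IHy].
- by case: n mn => // n mn; apply/ghost_star/IHx.
Qed.

Lemma ghost_span0 n : ghost_span n 0.
Proof.
have -> : 0 = free_sum [::] by rewrite /free_sum big_nil.
exact: ghost_free.
Qed.

Lemma ghost_spanZ n a x : ghost_span n x -> ghost_span n (a *: x).
Proof.
elim=> {n x} [n l lP|n x y _ IHx _ IHy|n x e _ IHx].
- have -> : a *: free_sum l = free_sum [seq (a * t.1.1, t.1.2, t.2) | t <- l].
    rewrite /free_sum scaler_sumr big_map; apply: eq_bigr => t _.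
    by rewrite scalerA.
  by apply: ghost_free => t /mapP[t' /lP ? ->].
- by rewrite scalerDr; exact: ghost_add.
- by rewrite nuscaleAl; exact: ghost_star.
Qed.

Lemma ghost_span_gp n x A : ghost_span n x -> ghost_span n (x ** p A).
Proof.
elim=> {n x} [n l lP|n x y _ IHx _ IHy|n x e xn IHx].
- have -> : free_sum l ** p A = free_sum [seq (t.1, gvI t.2 A) | t <- l].
    rewrite /free_sum numul_suml big_map; apply: eq_bigr => t _.
    by rewrite -nuscaleAl -sactM (lf_pI FAM).
  apply: ghost_free => t /mapP[t' /lP[tP ts] ->]; split=> //= v [/ts //].
- by rewrite numulDl; exact: ghost_add.
- rewrite -numulA s'_gp; case: ifP => _; first exact: ghost_star.
  by rewrite numulr0; exact: ghost_span0.
Qed.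

(** Multiplying by s_e cancels the last factor s_f^* of a ghost part. *)
Lemma ghost_span_s n x e : ghost_span n x -> ghost_span n.-1 (x ** s e).
Proof.
elim=> {n x} [n l lP|n x y _ IHx _ IHy|n x f xn IHx].
- have -> : free_sum l ** s e = free_sum
      [seq (t.1.1, rcons t.1.2 e, gvr e) | t <- l & src e \in gvset_set t.2].
    rewrite /free_sum numul_suml big_map big_filter [RHS]big_mkcond.
    apply: eq_bigr => t _; rewrite -nuscaleAl -sactM gp_s.
    case: ifP => _; last by rewrite sact0 scaler0.
    by rewrite -cats1 sact_cat /= (lf_sp FAM).
  apply: ghost_free => t /mapP[t'].
  rewrite mem_filter => /andP[/set_mem et /lP[tP ts]] ->.
  rewrite /= -cats1 path_rng_catr; split=> //.
  exact: is_path_catP (ts _ et) _ _.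
- by rewrite numulDl; exact: ghost_add.
- rewrite -numulA s'_s; case: ifP => _; first exact: ghost_span_gp.
  by rewrite numulr0; exact: ghost_span0.
Qed.

Lemma ghost_spanN n x : ghost_span n x -> ghost_span n (- x).
Proof. by rewrite -scaleN1r; exact: ghost_spanZ. Qed.

(** Without a unit, a span that is stable under right multiplication by the
    generators need not be everything; it must contain the generators too. *)
Lemma ghost_span_ex x : exists n, ghost_span n x.
Proof.
suff [] : (exists n, ghost_span n x) /\
  forall n z, ghost_span n z -> exists m, ghost_span m (z ** x) by [].
have free1 al A : is_path al -> gvset_set A `<=` path_rng al ->
    ghost_span 0 (sact al (p A)).
  move=> alP Aal; have -> : sact al (p A) = free_sum [:: (1, al, A)].
    by rewrite /free_sum big_seq1 scale1r.
  by apply: ghost_free => t; rewrite inE => /eqP ->.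
elim/quotW: x; elim=> [e|e|A||t [[m tm] IHt] u [[n un] IHu]|t [[m tm] IHt]
  |a t [[m tm] IHt]|t [[m tm] IHt] u [_ IHu]].
- split; last by move=> n z zn; exists n.-1; exact: ghost_span_s.
  exists 0%N; rewrite -[X in ghost_span _ X](lf_sp FAM e).
  exact: (free1 [:: e] (gvr e)).
- split=> [|n z zn]; last by exists n.+1; exact: ghost_star.
  exists 1%N; rewrite -[X in ghost_span _ X](lf_ps' FAM e).
  exact/ghost_star/(free1 [::]).
- split=> [|n z zn]; last by exists n; exact: ghost_span_gp.
  by exists 0%N; exact: (free1 [::]).
- split=> [|n z zn]; first by exists 0%N; exact: ghost_span0.
  by exists 0%N; rewrite [_ ** _]numulr0; exact: ghost_span0.
- rewrite -leavitt_addE; split=> [|k z zk].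
    exists (maxn m n); apply: ghost_add.
      exact: ghost_span_le (leq_maxl _ _) tm.
    exact: ghost_span_le (leq_maxr _ _) un.
  have [[m' tm'] [n' un']] := (IHt _ _ zk, IHu _ _ zk).
  exists (maxn m' n'); rewrite numulDr; apply: ghost_add.
    exact: ghost_span_le (leq_maxl _ _) tm'.
  exact: ghost_span_le (leq_maxr _ _) un'.
- rewrite -leavitt_oppE; split=> [|k z /IHt[n zn]].
    by exists m; exact: ghost_spanN.
  by exists n; rewrite numulrN; exact: ghost_spanN.
- rewrite -leavitt_scaleE; split=> [|k z /IHt[n zn]].
    by exists m; exact: ghost_spanZ.
  by exists n; rewrite -nuscaleAr; exact: ghost_spanZ.
- rewrite -leavitt_mulE; split=> [|k z /IHt[n /IHu]]; first exact: IHu tm.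
  by rewrite numulA.
Qed.

Lemma ghost_span0_free x : ghost_span 0 x -> exists2 l, admissible l & x = free_sum l.
Proof.
suff H n : ghost_span n x -> n = 0%N -> exists2 l, admissible l & x = free_sum l.
  by move=> /H; apply.
elim=> {n x} // [n l lP _|n x y _ IHx _ IHy n0]; first by exists l.
have [[l lP ->] [l' lP' ->]] := (IHx n0, IHy n0).
exists (l ++ l'); last by rewrite free_sum_cat.
by move=> t; rewrite mem_cat => /orP[/lP|/lP'].
Qed.

(** F collects the first edges of the ghost parts.  For such an edge e the
    defect of x s_e^* vanishes, by s_e^* s_f s_f^* = s_e^* if e = f and 0
    otherwise.  The claim is about all larger F1 so that it passes to sums. *)
Lemma ghost_span_defect n x : ghost_span n x ->
  exists l (F : seq (edge G)), admissible l /\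
    forall F1 : seq (edge G), uniq F1 -> {subset F <= F1} ->
    defect F1 x = defect F1 (free_sum l).
Proof.
elim=> {n x} [n l lP|n x y _ [l [F [lP lE]]] _ [l' [F' [lP' lE']]]|n x e _ _].
- by exists l, [::].
- exists (l ++ l'), (F ++ F'); split=> [t|F2 F2u F2s].
    by rewrite mem_cat => /orP[/lP|/lP'].
  rewrite free_sum_cat !defectD lE ?lE' //.
    by move=> e eF; apply: F2s; rewrite mem_cat eF orbT.
  by move=> e eF; apply: F2s; rewrite mem_cat eF.
- exists [::], [:: e]; split=> // F' F'u eF'.
  rewrite /free_sum big_nil defect0 defectM /defect.
  rewrite (bigD1_seq e) //=; last by apply: eF'; rewrite mem_head.
  rewrite s'_s eqxx (lf_ps' FAM) big1 ?addr0 ?subrr ?numulr0 // => f /negPf fe.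
  by rewrite s'_s eq_sym fe numul0r.
Qed.

End PathAlgebra.

(** * Leaving a loop that has an exit *)

(** If mu is a prefix of al mu, then |al| is a period of mu, and so are its
    multiples. *)
Lemma period_nth (T : Type) (x0 : T) (al mu de : seq T) k j : mu ++ de = al ++ mu ->
  (k * size al <= j < size mu)%N ->
  nth x0 mu (j - k * size al) = nth x0 mu j.
Proof.
move=> E; elim: k => [|k IH] => [_|/andP[kj jmu]]; first by rewrite subn0.
have kj' : (k * size al <= j)%N by apply: leq_trans kj; rewrite leq_mul.
rewrite -IH ?kj' //.
set i := (j - k * _)%N.
have imu : (i < size mu)%N by apply: leq_ltn_trans jmu; exact: leq_subr.
have -> : (j - k.+1 * size al = i - size al)%N by rewrite mulSn addnC subnDA.
have := congr1 (fun l => nth x0 l i) E; rewrite nth_cat imu nth_cat => ->.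
by rewrite ltnNge leq_subRL // -mulSnr kj.
Qed.

Section ExitWord.
Variable G : ultragraph.
Implicit Types (al be ga de mu : seq (edge G)) (v w : vertex G).

Definition closed_at v ga : Prop := [/\ is_path ga, starts ga v & path_rng ga v].

Lemma closed_at_loop v ga : closed_at v ga -> is_loop ga.
Proof. by case: ga => [|e l] [] //= gaP ev rv; split=> //; rewrite ev. Qed.

Lemma loop_next e ga j : is_loop ga ->
  rng (nth e ga (j %% size ga)) (src (nth e ga (j.+1 %% size ga))).
Proof.
move=> gaL; have p0 : (0 < size ga)%N by case: ga gaL.
rewrite {2}(divn_eq j (size ga)) -addnS modnMDl.
have := ltn_pmod j p0; move: (j %% size ga)%N => r.
rewrite leq_eqVlt => /orP[/eqP rp|rp].
  rewrite rp modnn; move: gaL rp; case: (ga) => //= f l [_ lf] [->].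
  by rewrite -last_nth.
rewrite modn_small //; case: (ga) gaL rp => // f l [/(sortedP e) gaP _] rp.
exact/set_mem/gaP.
Qed.

(** If ga has a sink w as exit, stop at w: no edge can follow.  If it has an
    edge e as exit, go around ga very often and then leave through e.  A path mu
    of this form cannot be a prefix of al mu for al in S: it would have the
    period |al|, hence also |ga| |al|, and moving back by that much from the
    final e leads to an edge of ga, the one that e avoids. *)
Lemma exit_word v (S : seq (seq (edge G))) ga :
    (forall de, de \in S -> closed_at v de) -> ga \in S ->
    ~ loop_without_exits ga ->
  exists mu w, [/\ is_path mu, starts mu v, path_rng mu w
    & forall al de, al \in S -> al ++ mu = mu ++ de -> ~ starts de w].
Proof.
move=> SP gaS gaX; have [gaP gav rv] := SP _ gaS.
have gaL : is_loop ga by apply: closed_at_loop (SP _ gaS).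
have [[w [ws [e ega ew]]]|noS] := pselect (exists w, sink_exit ga w).
  case/path.splitP: ega gaP gav => l1 l2 gaP gav {rv gaL gaX gaS}.
  exists (rcons l1 e), w; split.
  - move: gaP; rewrite /is_path; case: (l1) => //= f l.
    by rewrite cat_path => /andP[].
  - by move: gav; case: (l1).
  - by rewrite -cats1 path_rng_catr.
  - by move=> al [|f de] _ _ //= /ws.
have [[e [i [ip ei ne]]]|noE] := pselect (exists e, edge_exit ga e); last first.
  case: gaX; split=> // [e eX|w wX]; first by apply: noE; exists e.
  by apply: noS; exists w.
have [w ew] := rng_neq0 e; set q := size ga in ip ne.
have q0 : (0 < q)%N by exact: leq_ltn_trans ip.
(* K rounds leave room for |ga| |al| steps back, whatever al in S. *)
pose K := \max_(al <- S) size al; pose M := (K * q + i.+1)%N.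
pose mu := rcons (mkseq (fun j => nth e ga (j %% q)%N) M) e.
have smu : size mu = M.+1 by rewrite size_rcons size_mkseq.
have nmu j : (j < M)%N -> nth e mu j = nth e ga (j %% q)%N.
  by move=> jM; rewrite nth_rcons size_mkseq jM nth_mkseq.
have nM : nth e mu M = e by rewrite nth_rcons size_mkseq ltnn eqxx.
have Mi j : ((j * q + i.+1) %% q = i.+1 %% q)%N by rewrite modnMDl.
exists mu, w; split.
- apply/(sortedP e) => j; rewrite smu ltnS leq_eqVlt => /orP[/eqP jM|jM].
    rewrite jM nM nmu -?jM // (_ : j = K * q + i)%N.
      by rewrite modnMDl modn_small //; exact/mem_set.
    by move: jM; rewrite /M addnS => -[].
  rewrite !nmu //; last exact: ltnW.
  exact/mem_set/loop_next.
- have : nth e mu 0 = nth e ga 0 by rewrite nmu ?mod0n // /M addnS.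
  move: gav smu; case: (ga) => //= f l fv; case: (mu) => //= g m _ ->.
  exact: fv.
- by rewrite /mu -cats1 path_rng_catr.
- move=> al de alS E dew; have [_ alv _] := SP _ alS.
  have al0 : (0 < size al)%N by case: (al) alv.
  have alK : (size al <= K)%N by apply: leq_bigmax_seq.
  have qM : (q * size al <= M)%N.
    by rewrite mulnC (leq_trans _ (leq_addr _ _)) // leq_mul2r alK orbT.
  have := @period_nth _ e al mu de q M (esym E).
  rewrite smu qM leqnn => /(_ isT); rewrite nM nmu; last first.
    by rewrite -subn_gt0 subKn // muln_gt0 q0.
  rewrite /M (mulnC q) -addnBAC; last by rewrite leq_mul2r alK orbT.
  by rewrite -mulnBl modnMDl => /esym.
Qed.

End ExitWord.

(** * Ideals that meet the abelian core trivially *)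

Section Ideal.
Variables (R : comPzRingType) (G : ultragraph).
Implicit Types (e f : edge G) (u v w : vertex G) (A B : gvset G).
Implicit Types (al be ga de mu : seq (edge G)) (x y z : leavitt R G).

Local Notation L := (leavitt R G).
Local Notation s := (gs R).
Local Notation s' := (gs' R).
Local Notation p := (@gp R G).
Local Notation FAM := (leavitt_generators R G).

Implicit Types (t : fmonom R G) (l : seq (fmonom R G)).

Variable I : L -> Prop.
Hypothesis IMl : forall x y, I y -> I (x ** y).
Hypothesis IMr : forall x y, I x -> I (x ** y).
Hypothesis Icore : forall x, I x -> abelian_core R G x -> x = 0.

Lemma ideal_sstar al x : I x -> I (sstar al x).
Proof. by elim: al x => //= e al IH x Ix; apply/IH/IMl. Qed.

(** Either no path of S has an exit and the element is in the core,
    or the path of [exit_word] compresses it to c p_w. *)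
Lemma closed_coef_eq0 v (c : R) (d : seq (edge G) -> R) (S : seq (seq (edge G))) :
    (forall ga, ga \in S -> closed_at v ga) ->
    I (c *: p (gv1 v) + \sum_(ga <- S) d ga *: sact ga (p (gv1 v))) ->
  c = 0.
Proof.
move=> SP Iy.
have S0 ga : ga \in S -> ga <> [::] by move=> /SP[_ + _] ga0; rewrite ga0.
have [noX|/existsNP[ga /not_implyP[gaS gaX]]] :=
    pselect (forall ga, ga \in S -> loop_without_exits ga).
  apply: (vertex_coef_eq0 S0); apply: Icore Iy _; apply: core_sum => ga gaS.
  by split; [exact: noX|have [] := SP _ gaS].
have [mu [w [muP muv muw good]]] := exit_word SP gaS gaX.
apply: (@vertex_coef_eq0 R G w c (fun=> 0) [::]) => //.
have pw : p (gv1 w) ** p (gv1 w) = p (gv1 w) by apply: gp_sub.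
apply: Icore; last exact: core_sum.
have := IMl (p (gv1 w)) (ideal_sstar mu (IMr (sact mu (p (gv1 w))) Iy)).
congr I; rewrite numulDl -nuscaleAl gv1_sact // numul_suml sstarD sstarZ sstar_sum.
rewrite -[in sact mu _](cats0 mu) sstar_sact ?cats0 //.
rewrite numulDr -nuscaleAr pw big_nil numul_sumr big_seq big1 // => al alS.
rewrite -nuscaleAl -sactM gv1_sact // -sact_cat sstarZ -nuscaleAr.
have [alP alv alr] := SP _ alS.
have pP : is_path (al ++ mu) by exact: is_path_catP alr muP muv.
suff -> : p (gv1 w) ** sstar mu (sact (al ++ mu) (p (gv1 w))) = 0.
  by rewrite scaler0.
have [/prefixP[de E]|npre] := boolP (prefix mu (al ++ mu)); last first.
  by rewrite sstar_sact0 ?numulr0 // size_cat leq_addl.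
rewrite E sstar_sact; first last.
- by move: muw; rewrite -E; case: (mu) muv => // f l _; rewrite path_rng_catr.
- by rewrite -E.
apply: gv1_sact0; last exact: good alS E.
move=> de0; have := congr1 size E; rewrite de0 cats0 size_cat.
by case: (al) alv => //= f l _ /eqP; rewrite -[X in _ == X]add0n eqn_add2r.
Qed.

(** Multiply on the left by p_v s_be^*, for a shortest be with a nonzero
    coefficient: what remains is d(be) p_v and the terms of the paths that
    extend be by a closed path at v. *)
Lemma path_coef_eq0 v (d : seq (edge G) -> R) (S : seq (seq (edge G))) :
    uniq S -> (forall al, al \in S -> is_path al /\ path_rng al v) ->
    I (\sum_(al <- S) d al *: sact al (p (gv1 v))) ->
  forall al, al \in S -> d al = 0.
Proof.
move=> Su SP Iy al alS; apply: contrapT => /eqP dal.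
pose P n := has (fun be => (d be != 0) && (size be == n)) S.
have exP : exists n, P n.
  by exists (size al); apply/hasP; exists al; rewrite ?dal ?eqxx.
have [m /hasP[be beS /andP[dbe /eqP szbe]] minm] := ex_minnP exP.
move/eqP: dbe; apply.
have [beP bev] := SP _ beS.
pose T := [seq drop (size be) ga | ga <- S &
  [&& ga != be, prefix be ga & `[< starts (drop (size be) ga) v >]]].
apply: (@closed_coef_eq0 v (d be) (fun de => d (be ++ de)) T).
  move=> de /mapP[ga]; rewrite mem_filter => /andP[/and3P[_ /prefixP[ga' ->]]].
  rewrite drop_size_cat // => /asboolP st /SP[gaP gav] ->; split=> //.
    exact: is_path_catr gaP.
  by case: (ga') st gav => // f l _; rewrite path_rng_catr.
have pv : p (gv1 v) ** p (gv1 v) = p (gv1 v) by apply: gp_sub.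
have := IMl (p (gv1 v)) (ideal_sstar be Iy).
congr I; rewrite sstar_sum numul_sumr (bigD1_seq be) //=; congr (_ + _).
  by rewrite sstarZ -[in sact be _](cats0 be) sstar_sact ?cats0 // -nuscaleAr pv.
rewrite /T big_map big_filter [RHS]big_mkcondr big_seq_cond [RHS]big_seq_cond.
apply: eq_bigr => ga /andP[gaS gabe]; have [gaP gav] := SP _ gaS.
rewrite sstarZ -nuscaleAr.
have [dga|dga] := eqVneq (d ga) 0.
  rewrite dga scale0r; case: ifP => // /andP[/prefixP[ga' E] _].
  by rewrite E drop_size_cat // -E dga scale0r.
have szga : (size be <= size ga)%N.
  by rewrite szbe; apply: minm; apply/hasP; exists ga; rewrite ?dga ?eqxx.
have [/prefixP[ga' E]|npre] := boolP (prefix be ga); last first.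
  by rewrite sstar_sact0 // numulr0 scaler0.
rewrite E drop_size_cat // sstar_sact -?E //; case: asboolP => [st|nst] /=.
  by rewrite gv1_sact.
rewrite gv1_sact0 ?scaler0 // => ga'0.
by case/eqP: gabe; rewrite E ga'0 cats0.
Qed.

(** With y the combination that l stands for, the element is y p_v or y s_e p_w,
    where e has source v and w in its range; the suffix tau is empty in the
    first case and e in the second. *)
Lemma coef_eq0 l v tau w :
    admissible l ->
    (forall al, is_path al -> path_rng al v ->
       is_path (al ++ tau) /\ path_rng (al ++ tau) w) ->
    I (\sum_(t <- l | v \in gvset_set t.2)
         t.1.1 *: sact (t.1.2 ++ tau) (p (gv1 w))) ->
  forall al, coef l al v = 0.
Proof.
move=> lP tauP; rewrite -big_filter (big_fibers _ (fun t => t.1.2)).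
set r := [seq t <- l | _]; set S := undup _.
have coefE al : coef l al v = \sum_(t <- r | t.1.2 == al) t.1.1.
  by rewrite big_filter_cond.
have SP al : al \in S -> is_path al /\ path_rng al v.
  rewrite mem_undup => /mapP[t].
  rewrite mem_filter => /andP[/set_mem tv /lP[tP ts]] ->.
  by split=> //; exact: ts.
rewrite (eq_bigr (fun al => coef l al v *: sact (al ++ tau) (p (gv1 w)))); last first.
  move=> al _; rewrite coefE scaler_suml.
  by apply: eq_bigr => t /eqP ->.
move=> Isum al.
have [alS|alS] := boolP (al \in S); last first.
  rewrite coefE big_seq_cond big_pred0 // => t; apply/andP => -[tr /eqP tal].
  by move: alS; rewrite mem_undup -tal (map_f (fun t => t.1.2)).
(* [take] recovers al from al ++ tau. *)
pose d be := coef l (take (size be - size tau) be) v.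
have dE be : d (be ++ tau) = coef l be v by rewrite /d size_cat addnK take_size_cat.
rewrite -dE; apply: (@path_coef_eq0 w d [seq be ++ tau | be <- S]).
- rewrite map_inj_uniq ?undup_uniq //.
  apply: (can_inj (g := fun be => take (size be - size tau) be)) => be.
  by rewrite size_cat addnK take_size_cat.
- by move=> be /mapP[ga /SP[gaP gav] ->]; exact: tauP.
- by rewrite big_map; under eq_bigr do rewrite dE.
- by rewrite (map_f (fun be => be ++ tau)).
Qed.

(** The coefficients of l vanish at every vertex outside T, the set of vertices
    that emit edges of F and no other edge; on T the defect is zero. *)
Lemma free_defect_eq0 x l F : I x -> admissible l -> uniq F ->
  x = defect F (free_sum l) -> x = 0.
Proof.
move=> Ix lP Fu xE; set y := free_sum l in xE.
pose T := [seq v <- map (@src G) F | `[< forall e, src e = v -> e \in F >]].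
pose B := foldr (@gvU G) gv0 [seq t.2 | t <- l].
have TP v : v \in T -> defect F (p (gv1 v)) = 0.
  rewrite mem_filter => /andP[/asboolP vF /mapP[e eF ve]].
  by apply: defect_vertex => //; exists e.
have Bsub t : t \in l -> gvset_set t.2 `<=` gvset_set B.
  rewrite /B; elim: (l) => //= t' l' IH.
  by rewrite inE => /orP[/eqP -> u|/IH {}IH u /IH]; [left|right].
have yB : y ** p B = y.
  rewrite /y numul_suml; apply: eq_big_seq => t /Bsub tB.
  by rewrite -nuscaleAl -sactM gp_sub.
have yv v z : y ** p (gv1 v) ** z =
    \sum_(t <- l | v \in gvset_set t.2) t.1.1 *: sact t.1.2 (p (gv1 v) ** z).
  rewrite /y !numul_suml [RHS]big_mkcond; apply: eq_bigr => t _.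
  rewrite -!nuscaleAl -!sactM gp_vertex.
  by case: ifP => // _; rewrite numul0r sact0 scaler0.
have y0 : y ** (p B - p (gvI B (gvseq T))) = 0.
  apply: free_sum_eq0 => v _ /gvseqE; rewrite mem_filter => /negP.
  rewrite negb_and => /orP[/asboolPn/existsNP[e /not_implyP[ev eF]]|vF] al.
    (* v emits the edge e outside F, and x s_e = y s_e. *)
    have [w ew] := rng_neq0 e; apply: (coef_eq0 (tau := [:: e]) (w := w)) => //.
      move=> be beP bev; rewrite path_rng_catr; split=> //.
      exact: is_path_catP bev _ _.
    have := IMr (p (gv1 w)) (IMr (s e) Ix); congr I.
    have -> : x ** s e = y ** s e.
      rewrite xE /defect numulBr numul_suml big_seq big1 ?subr0 // => f fF.
      rewrite -numulA s'_s; case: eqP => [fe|]; last by rewrite numulr0.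
      by rewrite -fe fF in eF.
    rewrite -{1}(lf_ps FAM e) ev numulA -numulA yv; apply: eq_bigr => t _.
    by rewrite sact_cat /= numulA -ev (lf_ps FAM).
  (* v emits no edge of F, and x p_v = y p_v. *)
  apply: (coef_eq0 (tau := [::]) (w := v)) => //.
    by move=> be; rewrite cats0.
  have := IMr (p (gv1 v)) Ix; congr I.
  have pv : p (gv1 v) ** p (gv1 v) = p (gv1 v) by apply: gp_sub.
  rewrite xE /defect numulBr numul_suml big_seq big1 ?subr0 => [|f fF]; last first.
    rewrite -numulA s'_gp memNset ?numulr0 // => fv.
    by move: vF; rewrite -fv map_f.
  rewrite -{1}pv numulA yv; apply: eq_bigr => t _.
  by rewrite cats0 pv.
(* p_B is a right unit for y, so y is supported on T. *)
have yT : y = y ** p (gvseq T).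
  by move/eqP: y0; rewrite numulrB subr_eq0 -(lf_pI FAM) numulA yB => /eqP.
by rewrite xE yT defectM (defect_gvseq TP) numulr0.
Qed.

(** Induction on the ghost length of x: each x s_e is in I with smaller ghost
    length, so it is zero and x equals its own defect. *)
Theorem ideal_eq0 x : I x -> x = 0.
Proof.
have [n] := ghost_span_ex x; elim: n x => [|n IH] x xn Ix.
  have [l lP xl] := ghost_span0_free xn.
  apply: (free_defect_eq0 Ix lP (F := [::])) => //.
  by rewrite /defect big_nil subr0.
have [l [F [lP lE]]] := ghost_span_defect xn.
apply: (free_defect_eq0 Ix lP (undup_uniq F)).
rewrite -lE ?undup_uniq //; last by move=> e; rewrite mem_undup.
rewrite /defect big1 ?subr0 // => e _.
by rewrite (IH (x ** s e)) ?numul0r //; [exact: ghost_span_s xn|exact: IMr].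
Qed.

End Ideal.

Theorem theorem6p13 (G : ultragraph) (R : comPzRingType) (A : nuRingType)
    (Phi : {additive leavitt R G -> A})
    (PhiM : {morph Phi : x y / x ** y}) :
  injective Phi <-> {in abelian_core R G &, injective Phi}.
Proof.
split=> [Phi_inj x y _ _|Phi_core x y Phixy]; first exact: Phi_inj.
apply/eqP; rewrite -subr_eq0; apply/eqP.
apply: (@ideal_eq0 R G (fun z => Phi z = 0)).
- by move=> a z /= z0; rewrite PhiM z0 numulr0.
- by move=> z a /= z0; rewrite PhiM z0 numul0r.
- move=> z z0 zM; apply: Phi_core; rewrite ?z0 ?raddf0 //; first exact: mem_set.
  by apply: mem_set => B [[]].
- by rewrite raddfB Phixy subrr.
Qed.
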